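(* Let $X$ and $Y$ be real random variables with marginal distribution functions $F_1$ and $F_2$, such that the kernels $h_{F_1}$ and $h_{F_2}$ exist and are square integrable, with spectral decompositions (convergent in mean square) $$h_{F_1}(x_1,x_2)=\sum_{k=0}^\infty\lambda_kg_{1k}(x_1)g_{1k}(x_2),\qquad h_{F_2}(y_1,y_2)=\sum_{k=0}^\infty\mu_kg_{2k}(y_1)g_{2k}(y_2).$$ Write $\rho_{kl}(X,Y)=\rho[g_{1k}(X),g_{2l}(Y)]$ for the ordinary correlation between $g_{1k}(X)$ and $g_{2l}(Y)$. Then $$\kappa(X,Y)=\sum_{k=1}^\infty\sum_{l=1}^\infty\lambda_k\,\mu_l\,\rho_{kl}(X,Y)^2$$ and, if $X$ and $Y$ are non-degenerate, $$\rho^*(X,Y)=\frac{1}{\sqrt{\sum_k\lambda_k^2}\,\sqrt{\sum_l\mu_l^2}}\sum_{k=1}^\infty\sum_{l=1}^\infty\lambda_k\,\mu_l\,\rho_{kl}(X,Y)^2,$$ with convergence in mean square (which, the terms being real numbers, means convergence of the partial sums over $1\le k,l\le N$ as $N\to\infty$).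
   Context: For a real random variable $Z$ its distribution function is taken in the convention $F(z)=P(Z<z)+\tfrac12P(Z=z)$; no restriction is placed on distributions. With $Z_1,Z_2$ i.i.d. with distribution function $F$, define $$h_F(z_1,z_2)=-\tfrac12E\big(|z_1-z_2|-|z_1-Z_2|-|Z_1-z_2|+|Z_1-Z_2|\big).$$ The kernel $h_F$ exists if this expectation is finite for some $(z_1,z_2)$ (then for all), and it is square integrable if $Eh_F(Z_1,Z_2)^2<\infty$. A number $\lambda$ is an eigenvalue of $h_F$ with eigenfunction $g$ if $Eg(Z)^2=1$ and $\lambda g(z)=Eh_F(z,Z)g(Z)$. In the spectral decompositions, $\{g_{1k}\}$ (resp. $\{g_{2k}\}$) is a complete orthonormal system of $L_2(F_1)$ (resp. $L_2(F_2)$) consisting of eigenfunctions of $h_{F_1}$ (resp. $h_{F_2}$), with corresponding eigenvalues $\lambda_k\ge0$ (resp. $\mu_k\ge0$); the index $0$ is reserved for the constant function $1$, with $\lambda_0=\mu_0=0$. (If $L_2(F_i)$ is finite-dimensional the sums are finite.) With $(X_1,Y_1),(X_2,Y_2)$ i.i.d. copies of $(X,Y)$, $$\kappa(X,Y)=E\,h_{F_1}(X_1,X_2)h_{F_2}(Y_1,Y_2),\qquad \rho^*(X,Y)=\frac{\kappa(X,Y)}{\sqrt{\kappa(X,X)\kappa(Y,Y)}}.$$ *)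

(* Defs.v *)
From HB Require Import structures.
From mathcomp Require Import all_boot all_order all_algebra.
From mathcomp Require Import all_classical all_reals all_analysis.

Set Implicit Arguments.
Unset Strict Implicit.
Unset Printing Implicit Defensive.

Import Order.TTheory GRing.Theory Num.Theory.
Import numFieldNormedType.Exports.

Local Open Scope classical_set_scope.
Local Open Scope ring_scope.

(* A distribution function F is represented by the probability law mu on the
   line that it determines.  Independent copies Z_1, Z_2 with law mu are the two
   coordinate projections on R * R under the product law mu \x mu. *)

Definition kernel_summand (R : realType) (z1 z2 : R) (w : R * R) : R :=
  `|z1 - z2| - `|z1 - w.2| - `|w.1 - z2| + `|w.1 - w.2|.

Definition kernel_exists (R : realType) (mu : probability R R) : Prop :=
  exists z1 z2 : R,
    (mu \x mu)%E.-integrable [set: R * R] (EFin \o kernel_summand z1 z2).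

Definition h_kernel (R : realType) (mu : probability R R) (z1 z2 : R) : R :=
  - 2^-1 * fine ('E_(mu \x mu)[kernel_summand z1 z2])%E.

Definition kernel_square_integrable (R : realType) (mu : probability R R) :
    Prop :=
  ('E_(mu \x mu)[fun z : R * R => (h_kernel mu z.1 z.2 ^+ 2)%R] < +oo)%E.

(* Eigenfunctions are elements of L_2(mu): the eigenvalue equation is required
   for mu-almost every z. *)
Definition eigenfunction (R : realType) (mu : probability R R)
    (lam : R) (g : R -> R) : Prop :=
  [/\ g \in Lfun mu 2%:E,
      ('E_mu[fun z => (g z ^+ 2)%R] = 1)%E
    & {ae mu, forall z,
        lam * g z = fine ('E_mu[fun z' => (h_kernel mu z z' * g z')%R])%E}].

Definition orthonormal_on (R : realType) (mu : probability R R)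
    (D : set nat) (g : nat -> R -> R) : Prop :=
  (forall k, D k -> g k \in Lfun mu 2%:E) /\
  (forall k l, D k -> D l ->
    ('E_mu[fun z => (g k z * g l z)%R] = (k == l)%:R%:E)%E).

Definition complete_on (R : realType) (mu : probability R R)
    (D : set nat) (g : nat -> R -> R) : Prop :=
  forall f : R -> R, f \in Lfun mu 2%:E ->
    (forall k, D k -> ('E_mu[fun z => (f z * g k z)%R] = 0)%E) ->
    {ae mu, forall z, f z = 0}.

(* The index set D is {0, ..., n} when L_2(mu) is finite-dimensional and all of
   nat otherwise; lam and g are unconstrained outside D. *)
Record spectral_decomposition (R : realType) (mu : probability R R)
    (D : set nat) (lam : nat -> R) (g : nat -> R -> R) : Prop :=
  SpectralDecomposition {
    spectral_index0 : D 0%N ;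
    spectral_index_initial : forall k l, (k <= l)%N -> D l -> D k ;
    spectral_orthonormal : orthonormal_on mu D g ;
    spectral_complete : complete_on mu D g ;
    spectral_eigen : forall k, D k -> eigenfunction mu (lam k) (g k) ;
    spectral_ge0 : forall k, D k -> 0 <= lam k ;
    spectral_fun0 : g 0%N = cst 1 ;
    spectral_val0 : lam 0%N = 0 ;
    spectral_cvg :
      ('E_(mu \x mu)[fun z : R * R =>
         ((h_kernel mu z.1 z.2 -
           \sum_(0 <= k < N | k \in D) lam k * g k z.1 * g k z.2) ^+ 2)%R])%E
      @[N --> \oo] --> 0%E
  }.

Definition correlation (d : measure_display) (T : measurableType d)
    (R : realType) (P : probability T R) (U V : T -> R) : R :=
  fine (covariance P U V) /
  (Num.sqrt (fine ('V_P[U])%E) * Num.sqrt (fine ('V_P[V])%E)).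

(* Under P \x P, the pairs (X w.1, Y w.1) and (X w.2, Y w.2) are independent
   copies of (X, Y). *)
Definition kappa (d : measure_display) (T : measurableType d)
    (R : realType) (P : probability T R) (X Y : {RV P >-> R}) : R :=
  fine ('E_(P \x P)[fun w : T * T =>
    (h_kernel (distribution P X) (X w.1) (X w.2) *
     h_kernel (distribution P Y) (Y w.1) (Y w.2))%R])%E.

Arguments kappa {d T R} P X Y.

Definition rho_star (d : measure_display) (T : measurableType d)
    (R : realType) (P : probability T R) (X Y : {RV P >-> R}) : R :=
  kappa P X Y / Num.sqrt (kappa P X X * kappa P Y Y).

Arguments rho_star {d T R} P X Y.

Definition degenerate (d : measure_display) (T : measurableType d)
    (R : realType) (P : probability T R) (X : {RV P >-> R}) : Prop :=
  exists c : R, {ae P, forall t, X t = c}.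

Arguments degenerate {d T R} P X.

Definition square_partial_sum (R : realType) (D : set nat) (lam : nat -> R)
    (N : nat) : R :=
  \sum_(0 <= k < N | k \in D) lam k ^+ 2.

(* Sum over those 1 <= k, l <= N that lie in the index sets. *)
Definition double_partial_sum (d : measure_display) (T : measurableType d)
    (R : realType) (P : probability T R) (X Y : {RV P >-> R})
    (D1 : set nat) (lam : nat -> R) (g1 : nat -> R -> R)
    (D2 : set nat) (mu : nat -> R) (g2 : nat -> R -> R) (N : nat) : R :=
  \sum_(1 <= k < N.+1 | k \in D1) \sum_(1 <= l < N.+1 | l \in D2)
    lam k * mu l * correlation P (g1 k \o X) (g2 l \o Y) ^+ 2.

Arguments double_partial_sum {d T R} P X Y D1 lam g1 D2 mu g2 N.

(* Main.v *)
Require Import Defs.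
From HB Require Import structures.
From mathcomp Require Import all_boot all_order all_algebra.
From mathcomp Require Import all_classical all_reals all_analysis.
From mathcomp Require Import measurable_realfun ring lra.

(** Let [(X, Y)] and [(X', Y')] be independent copies. The quantity [kappa] is
    the inner product, in the space L2 of the product law [P \x P], of the two
    functions [h_X(X, X')] and [h_Y(Y, Y')]. Each spectral decomposition says
    that such a function is the L2 limit of the finite sums of
    [lam k * g k (X) * g k (X')]: mean square convergence with respect to the
    square of the marginal law is mean square convergence under [P \x P],
    because [(X, X')] has that law
    ([integral_independent_copies], [cvg_expansion]).

    By the Cauchy-Schwarz inequality an L2 inner product is jointly continuous
    ([cvg_inner]), so [kappa P X Y] is the limit of the inner products of the
    finite sums. These are explicit, since by Fubini's theorem the inner product
    of [u(X) u(X')] and [v(Y) v(Y')] is the square of [E u(X) v(Y)]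
    ([inner_twofold]); hence they equal
    [\sum_k \sum_l lam k * mu l * (E g1 k (X) g2 l (Y)) ^ 2].
    For indices [k, l >= 1] the eigenfunctions are centered, being orthogonal to
    the constant [1], and have variance [1], so that this expectation is a
    correlation ([correlation_eigenfunctions]); the terms of index [0] vanish
    with their eigenvalue ([double_partial_sumE]).

    Taking [Y = X] and using orthonormality, the same computation shows that
    [\sum_k lam k ^ 2] converges to [kappa P X X] ([cvg_square_partial_sum]).
    The formula for [rho_star] is then the quotient of these limits. *)

Set Implicit Arguments.
Unset Strict Implicit.
Unset Printing Implicit Defensive.

Import Order.TTheory GRing.Theory Num.Theory.
Import numFieldNormedType.Exports.

Local Open Scope classical_set_scope.
Local Open Scope ring_scope.

(** * Square-integrable functions and their inner product *)

Section L2_inner_product.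
Context (d : measure_display) (T : measurableType d) (R : realType).
Variable Q : {measure set T -> \bar R}.
Implicit Types f g h : T -> R.

Definition inner f g : R := \int[Q]_x (f x * g x).

Lemma Lfun2_measurable f : f \in Lfun Q 2%:E -> measurable_fun setT f.
Proof. by move=> /sub_Lfun_mfun; rewrite inE. Qed.

Lemma sqr_integral_Lfun2 f : measurable_fun setT f ->
  (\int[Q]_x (f x ^+ 2)%:E < +oo)%E -> f \in Lfun Q 2%:E.
Proof.
move=> mf foo; rewrite inE; apply/andP; split; rewrite inE//=.
rewrite /finite_norm unlock /= poweR_lty//.
rewrite (eq_integral (fun x => (f x ^+ 2)%:E))// => x _ /=.
by rewrite powR_mulrn// -normrX ger0_norm ?sqr_ge0.
Qed.

Lemma Lfun2_mul_integrable f g : f \in Lfun Q 2%:E -> g \in Lfun Q 2%:E ->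
  Q.-integrable setT (fun x => (f x * g x)%:E).
Proof. by move=> f2 g2; apply/Lfun1_integrable/Lfun2_mul_Lfun1. Qed.

Lemma Lfun2D f g : f \in Lfun Q 2%:E -> g \in Lfun Q 2%:E ->
  f + g \in Lfun Q 2%:E.
Proof. exact: (Lfun_addr_closed Q (lee1n 2)).2. Qed.

Lemma Lfun2Z a f : f \in Lfun Q 2%:E -> a *: f \in Lfun Q 2%:E.
Proof.
move=> f2; rewrite (_ : a *: f = a \o* f); last first.
  by apply/funext => x; rewrite /GRing.scale/= mulrC.
by apply: Lfun_scale; rewrite ?ler1n.
Qed.

Lemma Lfun2B f g : f \in Lfun Q 2%:E -> g \in Lfun Q 2%:E ->
  f - g \in Lfun Q 2%:E.
Proof. by move=> f2 g2; rewrite -scaleN1r; apply/Lfun2D/Lfun2Z. Qed.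

Lemma Lfun2_sum (I : Type) (r : seq I) (p : pred I) (F : I -> T -> R) :
  (forall i, p i -> F i \in Lfun Q 2%:E) ->
  \sum_(i <- r | p i) F i \in Lfun Q 2%:E.
Proof.
move=> F2; elim/big_ind : _ => //; last by move=> f g; exact: Lfun2D.
exact: (Lfun_addr_closed Q (lee1n 2)).1.
Qed.

Lemma innerC f g : inner f g = inner g f.
Proof. by apply: eq_Rintegral => x _; rewrite mulrC. Qed.

Lemma inner_ge0 f : 0 <= inner f f.
Proof. by apply: Rintegral_ge0 => x _; rewrite -expr2 sqr_ge0. Qed.

Lemma innerDl f g h : f \in Lfun Q 2%:E -> g \in Lfun Q 2%:E ->
  h \in Lfun Q 2%:E -> inner (f + g) h = inner f h + inner g h.
Proof.
move=> f2 g2 h2; rewrite /inner -RintegralD//; last 2 first.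
- exact: Lfun2_mul_integrable.
- exact: Lfun2_mul_integrable.
by apply: eq_Rintegral => x _; rewrite -mulrDl.
Qed.

Lemma innerZl a f h : f \in Lfun Q 2%:E -> h \in Lfun Q 2%:E ->
  inner (a *: f) h = a * inner f h.
Proof.
move=> f2 h2; rewrite /inner -RintegralZl//; last exact: Lfun2_mul_integrable.
by apply: eq_Rintegral => x _; rewrite mulrA.
Qed.

Lemma innerBl f g h : f \in Lfun Q 2%:E -> g \in Lfun Q 2%:E ->
  h \in Lfun Q 2%:E -> inner (f - g) h = inner f h - inner g h.
Proof.
move=> f2 g2 h2; rewrite -scaleN1r innerDl ?Lfun2Z// innerZl//.
by rewrite mulN1r.
Qed.

Lemma inner0l h : inner 0 h = 0.
Proof.
rewrite /inner -[RHS](mul0r (fine (Q setT))) -Rintegral_cst//.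
by apply: eq_Rintegral => x _ /=; rewrite mul0r.
Qed.

Lemma inner_suml (I : Type) (r : seq I) (p : pred I) (F : I -> T -> R) h :
  (forall i, p i -> F i \in Lfun Q 2%:E) -> h \in Lfun Q 2%:E ->
  inner (\sum_(i <- r | p i) F i) h = \sum_(i <- r | p i) inner (F i) h.
Proof.
move=> F2 h2; elim: r => [|i r IH]; first by rewrite !big_nil inner0l.
rewrite !big_cons; case: ifPn => // pi.
by rewrite innerDl ?IH//; [exact: F2|exact: Lfun2_sum].
Qed.

Lemma inner_cauchy_schwarz f g : f \in Lfun Q 2%:E -> g \in Lfun Q 2%:E ->
  inner f g ^+ 2 <= inner f f * inner g g.
Proof.
move=> f2 g2.
(* this is [inner (f - t *: g) (f - t *: g)] *)
have quad t : 0 <= inner f f - 2 * t * inner f g + t ^+ 2 * inner g g.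
  have := inner_ge0 (f - t *: g).
  have tg2 := Lfun2Z t g2; have fg2 := Lfun2B f2 tg2.
  rewrite innerBl// innerC innerBl// innerZl// [inner (t *: g) _]innerC.
  rewrite innerBl// [inner f (t *: g)]innerC !innerZl// [inner g f]innerC.
  rewrite [inner g (t *: g)]innerC innerZl//.
  by move=> h; apply: (le_trans h); rewrite le_eqVlt; apply/orP; left; apply/eqP; ring.
have := inner_ge0 g; rewrite le_eqVlt => /predU1P[g0|g0].
  rewrite -g0 mulr0; have [->|fg0] := eqVneq (inner f g) 0.
    by rewrite expr0n.
  (* [quad] is affine in [t] here; at this [t] it takes the value [-1] *)
  have := quad ((inner f f + 1) / (2 * inner f g)); rewrite -g0.
  have -> : 2 * ((inner f f + 1) / (2 * inner f g)) * inner f g = inner f f + 1.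
    by field.
  lra.
(* the minimum of the polynomial *)
have := quad (inner f g / inner g g).
rewrite -(pmulr_lge0 _ g0).
set a := inner f f; set b := inner f g; set c := inner g g in g0 *.
have -> : (a - 2 * (b / c) * b + (b / c) ^+ 2 * c) * c = a * c - b ^+ 2.
  by field; rewrite gt_eqF.
by rewrite subr_ge0.
Qed.

(** By Cauchy-Schwarz it is enough that one factor tends to [0] in mean square
    while the norm of the other one stays bounded, for which convergence of that
    norm is a convenient form. *)
Lemma cvg_inner0 (f_ g_ : nat -> T -> R) :
  (forall n, f_ n \in Lfun Q 2%:E) -> (forall n, g_ n \in Lfun Q 2%:E) ->
  inner (f_ n) (f_ n) @[n --> \oo] --> (0 : R) ->
  cvgn (fun n => inner (g_ n) (g_ n)) ->
  inner (f_ n) (g_ n) @[n --> \oo] --> (0 : R).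
Proof.
move=> f2 g2 f0 gc; apply: norm_cvg0.
have fg0 : Num.sqrt (inner (f_ n) (f_ n) * inner (g_ n) (g_ n)) @[n --> \oo]
    --> (0 : R).
  rewrite -sqrtr0 -[X in Num.sqrt X](mul0r (limn (fun n => inner (g_ n) (g_ n)))).
  apply: continuous_cvg; first exact: sqrt_continuous.
  exact: cvgM.
apply: squeeze_cvgr fg0; last exact: (cvg_cst (0 : R)).
apply: nearW => n; rewrite normr_ge0/= -sqrtr_sqr.
by rewrite ler_wsqrtr// inner_cauchy_schwarz.
Qed.

(** Expanding [f_ n = f - (f - f_ n)] and likewise [g_ n], every term but
    [inner f g] contains a factor that tends to [0] in mean square. *)
Lemma cvg_inner (f_ g_ : nat -> T -> R) f g :
  (forall n, f_ n \in Lfun Q 2%:E) -> (forall n, g_ n \in Lfun Q 2%:E) ->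
  f \in Lfun Q 2%:E -> g \in Lfun Q 2%:E ->
  inner (f - f_ n) (f - f_ n) @[n --> \oo] --> (0 : R) ->
  inner (g - g_ n) (g - g_ n) @[n --> \oo] --> (0 : R) ->
  inner (f_ n) (g_ n) @[n --> \oo] --> inner f g.
Proof.
move=> f_2 g_2 f2 g2 cf cg.
have ff2 n := Lfun2B f2 (f_2 n); have gg2 n := Lfun2B g2 (g_2 n).
have -> : (fun n => inner (f_ n) (g_ n)) = (fun n => inner f g
    - inner (f - f_ n) g - inner (g - g_ n) f
    + inner (f - f_ n) (g - g_ n)).
  apply/funext => n; rewrite [inner (f - f_ n) (g - _)]innerC.
  rewrite !innerBl// ![inner _ (f - f_ n)]innerC !innerBl//.
  by rewrite ![inner _ f]innerC; ring.
rewrite -[X in _ --> X]addr0 -[X in _ --> X + _]subr0 -[X in _ --> X - _ + _]subr0.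
apply: cvgD; last by apply: cvg_inner0 => //; apply/cvg_ex; exists 0.
apply: cvgB; last by apply: cvg_inner0 => //; exact: is_cvg_cst.
apply: cvgB; first exact: cvg_cst.
by apply: cvg_inner0 => //; exact: is_cvg_cst.
Qed.

End L2_inner_product.

(** * Independent copies *)

Section product_space.
Context (d : measure_display) (T : measurableType d) (R : realType).
Variable P : probability T R.

(** For a nonnegative function, Tonelli's theorem allows one variable at a time to
    be transported from the line to [T]. *)
Lemma integral_independent_copies (X : {RV P >-> R}) (F : R * R -> R) :
  measurable_fun setT F -> (forall z, 0 <= F z) ->
  (\int[distribution P X \x distribution P X]_z (F z)%:E =
   \int[P \x P]_w (F (X w.1, X w.2))%:E)%E.
Proof.
move=> mF F0.
have mX : measurable_fun setT X by exact: measurable_funP.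
have mFX : measurable_fun setT (EFin \o (fun w : T * T => F (X w.1, X w.2))).
  apply/measurable_EFinP; apply: (measurableT_comp mF).
  by apply: measurable_fun_pair; exact: measurableT_comp.
have mEF : measurable_fun setT (EFin \o F) by exact/measurable_EFinP.
have EF0 z : (0 <= (EFin \o F) z)%E by rewrite lee_fin.
rewrite !fubini_tonelli1// => [|w]; last exact: EF0.
rewrite ge0_integral_distribution//; last first.
- by move=> y; apply: integral_ge0 => z _; exact: EF0.
- exact: measurable_fun_fubini_tonelli_F.
apply: eq_integral => s _; rewrite /fubini_F/=.
rewrite (ge0_integral_distribution X (f := fun y => (F (X s, y))%:E))//.
  by apply/measurable_EFinP; apply: (measurableT_comp mF); exact: measurable_pair1.
by move=> y; exact: EF0.
Qed.

Definition twofold (u : T -> R) (w : T * T) : R := u w.1 * u w.2.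

Lemma twofold_measurable u : measurable_fun setT u ->
  measurable_fun setT (twofold u).
Proof. by move=> mu; apply: measurable_funM; exact: measurableT_comp. Qed.

Lemma twofold_Lfun2 u : u \in Lfun P 2%:E -> twofold u \in Lfun (P \x P)%E 2%:E.
Proof.
move=> u2; have mu := Lfun2_measurable u2.
apply: sqr_integral_Lfun2; first exact: twofold_measurable.
rewrite fubini_tonelli1; first last.
- by move=> w; rewrite lee_fin sqr_ge0.
- by apply/measurable_EFinP/measurable_funX; exact: twofold_measurable.
have iu := Lfun2_integrable_sqr u2.
have iE : (\int[P]_x (u x ^+ 2)%:E \is a fin_num)%E.
  exact: (integrable_fin_num _ iu).
rewrite (eq_integral (fun x => (u x ^+ 2)%:E * \int[P]_y (u y ^+ 2)%:E)%E); last first.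
  move=> x _; rewrite /fubini_F /twofold/= -integralZl//.
  by apply: eq_integral => y _; rewrite exprMn EFinM.
rewrite -(fineK iE) integralZr//.
by rewrite -(fineK iE) -EFinM ltry.
Qed.

(** The integrand is a product of the same function of each of two independent
    points, so that Fubini's theorem makes its integral a square. *)
Lemma inner_twofold u v : u \in Lfun P 2%:E -> v \in Lfun P 2%:E ->
  inner (P \x P)%E (twofold u) (twofold v) = inner P u v ^+ 2.
Proof.
move=> u2 v2.
have iuv := Lfun2_mul_integrable u2 v2.
have iE : (\int[P]_x (u x * v x)%:E \is a fin_num)%E.
  exact: (integrable_fin_num _ iuv).
have iter : (\int[P]_x fubini_F P (fun w => (twofold u w * twofold v w)%:E) x =
    \int[P]_x ((u x * v x)%:E * \int[P]_y (u y * v y)%:E))%E.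
  apply: eq_integral => x _; rewrite /fubini_F /twofold/= -integralZl//.
  by apply: eq_integral => y _; rewrite mulrACA EFinM.
have i2 := Lfun2_mul_integrable (twofold_Lfun2 u2) (twofold_Lfun2 v2).
rewrite /inner /Rintegral -integral12_prod_meas1//.
by rewrite iter -(fineK iE) integralZr// -(fineK iE) -EFinM.
Qed.

Lemma Lfun2_comp (X : {RV P >-> R}) (f : R -> R) :
  f \in Lfun (distribution P X) 2%:E -> f \o X \in Lfun P 2%:E.
Proof.
move=> f2; have mf := Lfun2_measurable f2.
apply: sqr_integral_Lfun2; first exact: measurableT_comp.
have /integrableP[mf2] := Lfun2_integrable_sqr f2.
rewrite ge0_integral_distribution//; last exact: measurableT_comp.
apply: le_lt_trans; rewrite le_eqVlt; apply/orP; left; apply/eqP.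
by apply: eq_integral => x _ /=; rewrite ger0_norm ?sqr_ge0.
Qed.

Lemma inner_comp (X : {RV P >-> R}) (f g : R -> R) :
  f \in Lfun (distribution P X) 2%:E -> g \in Lfun (distribution P X) 2%:E ->
  inner P (f \o X) (g \o X) = fine ('E_(distribution P X)[fun z => (f z * g z)%R])%E.
Proof.
move=> f2 g2; rewrite unlock integral_distribution//.
- apply/measurable_EFinP/measurable_funM.
    exact: Lfun2_measurable f2.
  exact: Lfun2_measurable g2.
- by apply: (@Lfun2_mul_integrable _ _ _ P (f \o X) (g \o X)); exact: Lfun2_comp.
Qed.

End product_space.

(** * Measurability of the kernel *)

Section kernel.
Context (R : realType).

(** The integral of a section is by definition the difference of the integrals of
    its positive and negative parts, and Tonelli's theorem makes each of these
    measurable in [x], even where both are infinite. *)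
Lemma measurable_integral_section d1 d2 (T1 : measurableType d1)
    (T2 : measurableType d2) (m : {sigma_finite_measure set T2 -> \bar R})
    (f : T1 * T2 -> \bar R) : measurable_fun setT f ->
  measurable_fun setT (fun x => \int[m]_y f (x, y))%E.
Proof.
move=> mf.
have -> : (fun x => \int[m]_y f (x, y))%E =
    (fun x => fubini_F m f^\+ x - fubini_F m f^\- x)%E.
  by apply/funext => x; rewrite integralE /fubini_F !unlock.
apply: emeasurable_funB; apply: measurable_fun_fubini_tonelli_F => //.
- exact: measurable_funepos.
- exact: measurable_funeneg.
Qed.

Lemma measurable_expectation_section d1 d2 (T1 : measurableType d1)
    (T2 : measurableType d2) (m : probability T2 R)
    (f : T1 -> T2 * T2 -> R) :
  measurable_fun setT (fun p : T1 * (T2 * T2) => f p.1 p.2) ->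
  measurable_fun setT (fun x => 'E_(m \x m)[f x])%E.
Proof.
move=> mf; under eq_fun => x do rewrite unlock.
apply: (@measurable_integral_section _ _ _ _ _ (fun p => (f p.1 p.2)%:E)).
exact/measurable_EFinP.
Qed.

Lemma h_kernel_measurable (mu : probability R R) :
  measurable_fun setT (fun z : R * R => h_kernel mu z.1 z.2).
Proof.
apply: measurable_funM => //.
apply: (measurableT_comp (fine_measurable measurableT)).
apply: (@measurable_expectation_section _ _ _ _ mu
  (fun z : R * R => kernel_summand z.1 z.2)).
by repeat first [apply: measurable_funD | apply: measurable_funB
  | apply: measurableT_comp => // | done].
Qed.

End kernel.

(** * Spectral expansions in L2 of the product *)

Section spectral_expansion.
Context (d : measure_display) (T : measurableType d) (R : realType).
Variable P : probability T R.

Definition kernel_of (X : {RV P >-> R}) (w : T * T) : R :=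
  h_kernel (distribution P X) (X w.1) (X w.2).

Definition expansion (X : {RV P >-> R}) (D : set nat) (lam : nat -> R)
    (g : nat -> R -> R) (N : nat) : T * T -> R :=
  \sum_(0 <= k < N | k \in D) lam k *: twofold (g k \o X).

Lemma kappaE (X Y : {RV P >-> R}) :
  kappa P X Y = inner (P \x P)%E (kernel_of X) (kernel_of Y).
Proof. by rewrite /kappa unlock. Qed.

Lemma kernel_of_Lfun2 (X : {RV P >-> R}) :
  kernel_square_integrable (distribution P X) ->
  kernel_of X \in Lfun (P \x P)%E 2%:E.
Proof.
rewrite /kernel_square_integrable unlock => hoo.
have mh := h_kernel_measurable (distribution P X).
apply: sqr_integral_Lfun2.
  apply: (measurableT_comp (g := fun w : T * T => (X w.1, X w.2)) mh).
  by apply: measurable_fun_pair; exact: measurableT_comp.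
rewrite -(integral_independent_copies X
  (F := fun z => h_kernel (distribution P X) z.1 z.2 ^+ 2))//.
- exact: measurable_funX.
- by move=> z; exact: sqr_ge0.
Qed.

Section one_variable.
Variables (X : {RV P >-> R}) (D : set nat) (lam : nat -> R) (g : nat -> R -> R).
Hypothesis sp : spectral_decomposition (distribution P X) D lam g.

Lemma spectral_Lfun2 k : k \in D -> g k \in Lfun (distribution P X) 2%:E.
Proof. by rewrite inE => Dk; exact: (spectral_orthonormal sp).1. Qed.

Lemma inner_eigenfunctions k l : k \in D -> l \in D ->
  inner P (g k \o X) (g l \o X) = (k == l)%:R.
Proof.
move=> Dk Dl; rewrite inner_comp ?spectral_Lfun2//.
by rewrite (spectral_orthonormal sp).2//; exact/set_mem.
Qed.

Lemma expansion_summand_Lfun2 k : k \in D ->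
  lam k *: twofold (g k \o X) \in Lfun (P \x P)%E 2%:E.
Proof. by move=> Dk; apply/Lfun2Z/twofold_Lfun2/Lfun2_comp/spectral_Lfun2. Qed.

Lemma expansion_Lfun2 N : expansion X D lam g N \in Lfun (P \x P)%E 2%:E.
Proof. by apply: Lfun2_sum => k Dk; exact: expansion_summand_Lfun2. Qed.

Lemma expansionE N w : expansion X D lam g N w =
  \sum_(0 <= k < N | k \in D) lam k * g k (X w.1) * g k (X w.2).
Proof.
by rewrite /expansion fct_sumE; apply: eq_bigr => k _; rewrite -mulrA.
Qed.

Lemma cvg_expansion :
  inner (P \x P)%E (kernel_of X - expansion X D lam g N)
    (kernel_of X - expansion X D lam g N) @[N --> \oo] --> (0 : R).
Proof.
have /fine_cvg := spectral_cvg sp; apply: cvg_trans.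
apply: near_eq_cvg; apply: nearW => N.
rewrite unlock /inner /Rintegral; congr fine.
rewrite integral_independent_copies; last first.
- by move=> z; exact: sqr_ge0.
- apply: measurable_funX; apply: measurable_funB; first exact: h_kernel_measurable.
  apply: (eq_measurable_fun (fun z : R * R => \sum_(0 <= k < N)
      if k \in D then lam k * g k z.1 * g k z.2 else 0)).
    by move=> z _; rewrite [RHS]big_mkcond.
  apply: measurable_sum => k; case: (boolP (k \in D)) => // Dk.
  have mg := Lfun2_measurable (spectral_Lfun2 Dk).
  by apply: measurable_funM; [apply: measurable_funM => //|]; exact: measurableT_comp.
by apply: eq_integral => w _; rewrite -expr2 !fctE expansionE.
Qed.

(** The mean is the inner product with [g 0], the constant function [1]. *)
Lemma expectation_eigenfunction k : k \in D -> (0 < k)%N ->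
  'E_P[g k \o X]%E = 0%E.
Proof.
move=> Dk k0.
have D0 : 0%N \in D by exact/mem_set/(spectral_index0 sp).
have := inner_eigenfunctions Dk D0; rewrite gtn_eqF//.
rewrite (spectral_fun0 sp) /inner/= => h0.
have g1 : g k \o X \in Lfun P 1%E.
  apply: Lfun_subset12; first exact: fin_num_measure.
  exact/Lfun2_comp/spectral_Lfun2.
rewrite -(fineK (expectation_fin_num g1)) unlock; apply: (congr1 EFin).
by rewrite -[RHS]h0; apply: eq_Rintegral => x _ /=; rewrite mulr1.
Qed.

End one_variable.

Section two_variables.
Variables (X Y : {RV P >-> R}) (D1 D2 : set nat) (lam mu : nat -> R).
Variables (g1 g2 : nat -> R -> R).
Hypothesis spX : spectral_decomposition (distribution P X) D1 lam g1.
Hypothesis spY : spectral_decomposition (distribution P Y) D2 mu g2.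

(** A double sum of the terms computed by [inner_twofold]. They are left as inner
    products, not correlations, so that orthonormality applies in the case
    [Y = X]. *)
Lemma inner_expansion M N :
  inner (P \x P)%E (expansion X D1 lam g1 M) (expansion Y D2 mu g2 N) =
  \sum_(0 <= k < M | k \in D1) \sum_(0 <= l < N | l \in D2)
    lam k * mu l * inner P (g1 k \o X) (g2 l \o Y) ^+ 2.
Proof.
rewrite inner_suml; last 2 first.
- by move=> k; exact: expansion_summand_Lfun2.
- exact: expansion_Lfun2.
apply: eq_bigr => k Dk; rewrite innerC inner_suml; last 2 first.
- by move=> l; exact: expansion_summand_Lfun2.
- exact: (expansion_summand_Lfun2 spX Dk).
have u2 := Lfun2_comp (spectral_Lfun2 spX Dk).
apply: eq_bigr => l Dl; have v2 := Lfun2_comp (spectral_Lfun2 spY Dl).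
rewrite innerZl ?twofold_Lfun2 ?Lfun2Z ?twofold_Lfun2// innerC.
rewrite innerZl ?twofold_Lfun2//.
by rewrite inner_twofold// mulrCA mulrA.
Qed.

(** Eigenfunctions of positive index are standardized: their mean is [0] and
    their variance [1]. *)
Lemma correlation_eigenfunctions k l : k \in D1 -> l \in D2 ->
  (0 < k)%N -> (0 < l)%N ->
  correlation P (g1 k \o X) (g2 l \o Y) = inner P (g1 k \o X) (g2 l \o Y).
Proof.
move=> Dk Dl k0 l0.
have centered (U V : T -> R) : 'E_P[U]%E = 0%E -> 'E_P[V]%E = 0%E ->
    covariance P U V = ('E_P[(U * V)%R])%E.
  move=> U0 V0; rewrite unlock U0 V0; congr expectation.
  by apply/funext => x /=; rewrite !fctE/= !subr0.
have EU := expectation_eigenfunction spX Dk k0.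
have EV := expectation_eigenfunction spY Dl l0.
have var1 (Z : {RV P >-> R}) D' la g m :
    spectral_decomposition (distribution P Z) D' la g ->
    m \in D' -> (0 < m)%N -> fine ('V_P[g m \o Z])%E = 1.
  move=> sp Dm m0; rewrite /variance centered ?(expectation_eigenfunction sp)//.
  by have := inner_eigenfunctions sp Dm Dm; rewrite eqxx unlock.
rewrite /correlation (var1 _ _ _ _ _ spX)// (var1 _ _ _ _ _ spY)//.
by rewrite sqrtr1 mulr1 divr1 centered// unlock.
Qed.

Lemma double_partial_sumE N : double_partial_sum P X Y D1 lam g1 D2 mu g2 N =
  inner (P \x P)%E (expansion X D1 lam g1 N.+1) (expansion Y D2 mu g2 N.+1).
Proof.
(* the eigenvalue of index [0] is [0], so sums may start at [0] or at [1] *)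
have drop0 (D : set nat) (F : nat -> R) : F 0%N = 0 ->
    \sum_(0 <= k < N.+1 | k \in D) F k = \sum_(1 <= k < N.+1 | k \in D) F k.
  by move=> F0; rewrite big_ltn_cond//= F0 add0r; case: ifP.
rewrite inner_expansion drop0; last first.
  by rewrite big1// => l _; rewrite (spectral_val0 spX) !mul0r.
rewrite /double_partial_sum big_nat_cond [RHS]big_nat_cond.
apply: eq_bigr => k /andP[/andP[k0 _] Dk].
rewrite drop0; last by rewrite (spectral_val0 spY) mulr0 mul0r.
rewrite big_nat_cond [RHS]big_nat_cond.
apply: eq_bigr => l /andP[/andP[l0 _] Dl].
by rewrite correlation_eigenfunctions.
Qed.

End two_variables.

(** Orthonormality leaves only the diagonal terms of the double sum. *)
Lemma square_partial_sumE (X : {RV P >-> R}) D lam g N :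
  spectral_decomposition (distribution P X) D lam g ->
  square_partial_sum D lam N =
  inner (P \x P)%E (expansion X D lam g N) (expansion X D lam g N).
Proof.
move=> sp; rewrite (inner_expansion sp sp) /square_partial_sum.
rewrite big_nat_cond [RHS]big_nat_cond.
apply: eq_bigr => k /andP[kN Dk].
rewrite big_mkcond (bigD1_seq k) ?mem_index_iota ?iota_uniq//= Dk.
rewrite (inner_eigenfunctions sp)// eqxx expr1n mulr1 big1 ?addr0// => l lk.
case: ifPn => // Dl; rewrite (inner_eigenfunctions sp)// eq_sym (negbTE lk).
by rewrite expr0n mulr0.
Qed.

Lemma cvg_square_partial_sum (X : {RV P >-> R}) D lam g :
  kernel_square_integrable (distribution P X) ->
  spectral_decomposition (distribution P X) D lam g ->
  square_partial_sum D lam N @[N --> \oo] --> kappa P X X.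
Proof.
move=> hX sp; rewrite kappaE.
under eq_fun => N do rewrite (square_partial_sumE _ sp).
apply: cvg_inner.
- by move=> N; exact: expansion_Lfun2.
- by move=> N; exact: expansion_Lfun2.
- exact: kernel_of_Lfun2.
- exact: kernel_of_Lfun2.
- exact: cvg_expansion.
- exact: cvg_expansion.
Qed.

Lemma cvg_double_partial_sum (X Y : {RV P >-> R}) D1 lam g1 D2 mu g2 :
  kernel_square_integrable (distribution P X) ->
  kernel_square_integrable (distribution P Y) ->
  spectral_decomposition (distribution P X) D1 lam g1 ->
  spectral_decomposition (distribution P Y) D2 mu g2 ->
  double_partial_sum P X Y D1 lam g1 D2 mu g2 N @[N --> \oo] --> kappa P X Y.
Proof.
move=> hX hY spX spY; rewrite kappaE.
pose S N := inner (P \x P)%E (expansion X D1 lam g1 N) (expansion Y D2 mu g2 N).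
have -> : (fun N => double_partial_sum P X Y D1 lam g1 D2 mu g2 N) =
    [sequence S N.+1]_N.
  by apply/funext => N; exact: double_partial_sumE.
rewrite cvg_shiftS.
apply: cvg_inner.
- by move=> N; exact: expansion_Lfun2.
- by move=> N; exact: expansion_Lfun2.
- exact: kernel_of_Lfun2.
- exact: kernel_of_Lfun2.
- exact: cvg_expansion.
- exact: cvg_expansion.
Qed.

End spectral_expansion.

Unset Implicit Arguments.
Set Strict Implicit.
Set Printing Implicit Defensive.


Theorem theorem3 (d : measure_display) (T : measurableType d) (R : realType)
    (P : probability T R) (X Y : {RV P >-> R})
    (D1 D2 : set nat) (lam mu : nat -> R) (g1 g2 : nat -> R -> R)
    (existsX : kernel_exists (distribution P X))
    (existsY : kernel_exists (distribution P Y))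
    (square_integrableX : kernel_square_integrable (distribution P X))
    (square_integrableY : kernel_square_integrable (distribution P Y))
    (spectralX : spectral_decomposition (distribution P X) D1 lam g1)
    (spectralY : spectral_decomposition (distribution P Y) D2 mu g2) :
  (double_partial_sum P X Y D1 lam g1 D2 mu g2 N @[N --> \oo] -->
    kappa P X Y)
  /\
  (~ degenerate P X -> ~ degenerate P Y ->
    [/\ cvgn (square_partial_sum D1 lam),
        cvgn (square_partial_sum D2 mu)
      & 1 / (Num.sqrt (limn (square_partial_sum D1 lam)) *
             Num.sqrt (limn (square_partial_sum D2 mu))) *
        double_partial_sum P X Y D1 lam g1 D2 mu g2 N @[N --> \oo] -->
          rho_star P X Y]).
Proof.
have cXY := cvg_double_partial_sum square_integrableX square_integrableY
  spectralX spectralY.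
have cX := cvg_square_partial_sum square_integrableX spectralX.
have cY := cvg_square_partial_sum square_integrableY spectralY.
split=> // _ _; split; [exact: cvgP cX|exact: cvgP cY|].
rewrite (cvg_lim _ cX)// (cvg_lim _ cY)//.
rewrite /rho_star sqrtrM; last by rewrite kappaE inner_ge0.
rewrite [kappa P X Y / _]mulrC -[(_ * _)^-1 * kappa _ _ _]mul1r mulrA.
by apply: cvgM => //; exact: cvg_cst.
Qed.
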